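(* Let $k, L, d_f, d$ be positive integers with $d > k$. Let $\mathbf{W}_1 \in \mathbb{R}^{d_f \times k}$, $\mathbf{W}_2 \in \mathbb{R}^{d \times d_f}$, $\mathbf{W}_3 \in \mathbb{R}^{d \times k}$, and let $\omega: \mathbb{R}\to\mathbb{R}$ be any function satisfying $|\omega(x)| \leq |x|$ for every $x \in \mathbb{R}$. For $\mathbf{X} \in \mathbb{R}^{k \times L}$ define $$ \boldsymbol{\Phi}(\mathbf{X}) = \mathbf{W}_3 \mathbf{X} + \mathbf{W}_2\, \omega(\mathbf{W}_1 \mathbf{X}) \in \mathbb{R}^{d \times L}, $$ where $\omega$ is applied entrywise. Then for every $\mathbf{X} \in \mathbb{R}^{k\times L}$ and every $\varepsilon > 0$, $$ \left|\left\{ j \;\middle|\; \sigma_j(\boldsymbol{\Phi}(\mathbf{X})) > \varepsilon \|\mathbf{W}_2\|_2 \|\mathbf{W}_1\mathbf{X}\|_2 \right\}\right| \leq (1 + \varepsilon^{-2})\,k. $$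
   Context: $\sigma_1(\mathbf{A}) \geq \sigma_2(\mathbf{A}) \geq \cdots \geq 0$ denote the singular values of a matrix $\mathbf{A}$ (for a $d\times L$ matrix, $1 \leq j \leq \min(d,L)$), and $\|\cdot\|_2$ is the spectral norm. *)

(* Defs.v *)
From mathcomp Require Import all_boot all_order all_algebra.
From mathcomp Require Import polyrcf.
From mathcomp Require Import boolp classical_sets reals.

Set Implicit Arguments.
Unset Strict Implicit.
Unset Printing Implicit Defensive.

Import Order.TTheory GRing.Theory Num.Theory.

Local Open Scope ring_scope.

(* [rootsR p] is the increasing list of the distinct real roots of [p], hence
   the reversal.  The Gram matrix is symmetric, so all its [n] eigenvalues are
   real and geometric and algebraic multiplicities agree. *)
Definition gram_eigenvalues (R : realType) (m n : nat) (A : 'M[R]_(m, n)) :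
    seq R :=
  let p := char_poly (A^T *m A) in
  flatten [seq nseq (mup x p) x | x <- rev (rootsR p)].

(* Indices start at 0: [singular_value A j] is sigma_(j+1)(A).  It is meaningful
   for [j < minn m n]; it vanishes for larger [j]. *)
Definition singular_value (R : realType) (m n : nat) (A : 'M[R]_(m, n))
    (j : nat) : R :=
  Num.sqrt (gram_eigenvalues A)`_j.

Definition l2norm (R : realType) (n : nat) (x : 'cV[R]_n) : R :=
  Num.sqrt (\sum_(i < n) x i 0 ^+ 2).

(* The operator norm induced by the Euclidean norms. Taking the unit ball rather
   than the unit sphere keeps the set nonempty when [n = 0]. *)
Definition spectral_norm (R : realType) (m n : nat) (A : 'M[R]_(m, n)) : R :=
  sup [set l2norm (A *m x) | x in [set x : 'cV[R]_n | l2norm x <= 1]]%classic.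

Definition Phi (R : realType) (k L df d : nat)
    (W1 : 'M[R]_(df, k)) (W2 : 'M[R]_(d, df)) (W3 : 'M[R]_(d, k))
    (omega : R -> R) (X : 'M[R]_(k, L)) : 'M[R]_(d, L) :=
  W3 *m X + W2 *m map_mx omega (W1 *m X).

(* Main.v *)
(** Put t = eps |W2| |W1 X| and let Q be the orthonormal family of eigenvectors
    of Phi^T Phi whose eigenvalues exceed t^2; it has at least as many members
    as the set to be counted.  The linear map X kills a subspace of codimension
    at most k of the span of Q, on which Phi acts as W2 omega(W1 X).  For an
    orthonormal basis U (M rows) of that subspace, M t^2 < |Phi U^T|_F^2 unless
    M = 0, whereas
      |Phi U^T|_F^2 <= |W2|^2 |omega(W1 X)|_F^2 <= |W2|^2 |W1 X|_F^2
                    <= |W2|^2 k |W1 X|^2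
    because W1 X has rank at most k.  Hence M <= k / eps^2. *)
Require Import Defs.
From mathcomp Require Import all_boot all_order all_algebra.
From mathcomp Require Import polyrcf.
From mathcomp Require Import boolp classical_sets reals.
From mathcomp Require Import ring.

Set Implicit Arguments.
Unset Strict Implicit.
Unset Printing Implicit Defensive.

Import Order.TTheory GRing.Theory Num.Theory.

Local Open Scope ring_scope.

(** * Squared Frobenius norm as a trace *)

Definition frobsq (R : realFieldType) (m n : nat) (A : 'M[R]_(m, n)) : R :=
  \tr (A *m A^T).

Lemma frobsqE (R : realFieldType) m n (A : 'M[R]_(m, n)) :
  frobsq A = \sum_i \sum_j A i j ^+ 2.
Proof.
by apply: eq_bigr => i _; rewrite mxE; apply: eq_bigr => j _; rewrite mxE expr2.
Qed.

Lemma frobsq_ge0 (R : realFieldType) m n (A : 'M[R]_(m, n)) : 0 <= frobsq A.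
Proof. by rewrite frobsqE; do 2 (apply: sumr_ge0 => ? _); exact: sqr_ge0. Qed.

Lemma frobsq_eq0 (R : realFieldType) m n (A : 'M[R]_(m, n)) :
  (frobsq A == 0) = (A == 0).
Proof.
apply/eqP/eqP => [|->]; last by rewrite /frobsq mul0mx mxtrace0.
rewrite frobsqE => /psumr_eq0P A0; apply/matrixP => i j; rewrite mxE.
have /psumr_eq0P Ai0 : \sum_j A i j ^+ 2 = 0.
  by apply: A0 => // k _; apply: sumr_ge0 => ? _; exact: sqr_ge0.
by apply/eqP; rewrite -sqrf_eq0 Ai0// => ? _; exact: sqr_ge0.
Qed.

Lemma frobsq_0 (R : realFieldType) m n : frobsq (0 : 'M[R]_(m, n)) = 0.
Proof. by apply/eqP; rewrite frobsq_eq0. Qed.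

Lemma frobsqZ (R : realFieldType) m n (a : R) (A : 'M[R]_(m, n)) :
  frobsq (a *: A) = a ^+ 2 * frobsq A.
Proof.
by rewrite /frobsq linearZ -scalemxAl -scalemxAr scalerA mxtraceZ expr2.
Qed.

Lemma frobsq_tr (R : realFieldType) m n (A : 'M[R]_(m, n)) :
  frobsq A^T = frobsq A.
Proof. by rewrite /frobsq trmxK mxtrace_mulC. Qed.

Lemma frobsq_sum_col (R : realFieldType) m n (A : 'M[R]_(m, n)) :
  frobsq A = \sum_j frobsq (col j A).
Proof.
rewrite frobsqE exchange_big; apply: eq_bigr => j _.
by rewrite frobsqE; apply: eq_bigr => i _; rewrite big_ord1 mxE.
Qed.

Lemma frobsq_orthonormal (R : realFieldType) m n (Q : 'M[R]_(m, n)) :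
  Q *m Q^T = 1%:M -> frobsq Q = m%:R.
Proof. by move=> QQ; rewrite /frobsq QQ mxtrace1. Qed.

(** Pythagoras: [C] is the orthogonal projector onto the complement of the row space of [Q], and the
    defect of the inequality is exactly [frobsq (A *m C)]. *)
Lemma frobsq_mul_orthonormal_le (R : realFieldType) m n p (A : 'M[R]_(p, n))
    (Q : 'M[R]_(m, n)) :
  Q *m Q^T = 1%:M -> frobsq (A *m Q^T) <= frobsq A.
Proof.
move=> QQ; pose C := 1%:M - Q^T *m Q.
have CC : C *m C^T = C.
  rewrite /C linearB /= trmx1 trmx_mul trmxK mulmxBr mulmx1 mulmxBl mul1mx.
  by rewrite !mulmxA -(mulmxA Q^T Q) QQ mulmx1 subrr subr0.
rewrite -subr_ge0; suff -> : frobsq A - frobsq (A *m Q^T) = frobsq (A *m C).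
  exact: frobsq_ge0.
rewrite /frobsq !trmx_mul trmxK [in RHS]mulmxA -[in RHS](mulmxA A C) CC.
rewrite -raddfB /=.
by rewrite /C mulmxBr mulmxBl mulmx1 !mulmxA.
Qed.

(** * Orthonormal families in a row space *)

Lemma orthonormal_row_free (R : realFieldType) m n (Q : 'M[R]_(m, n)) :
  Q *m Q^T = 1%:M -> row_free Q.
Proof. by move=> QQ; apply/row_freeP; exists Q^T. Qed.

Lemma normalized_row (R : rcfType) n (u : 'rV[R]_n) (s := Num.sqrt (frobsq u)) :
  u != 0 -> s != 0 /\ (s^-1 *: u) *m (s^-1 *: u)^T = 1%:M.
Proof.
move=> u0; have fu : 0 < frobsq u by rewrite lt_def frobsq_eq0 u0 frobsq_ge0.
split; first by rewrite gt_eqF ?sqrtr_gt0.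
rewrite linearZ /= -scalemxAl -scalemxAr scalerA -expr2 exprVn sqr_sqrtr ?ltW//.
by rewrite {1}[u *m _]mx11_scalar scale_scalar_mx -trace_mx11 mulVf ?gt_eqF.
Qed.

Lemma unit_row_sub (R : rcfType) m n (A : 'M[R]_(m, n)) :
  A != 0 -> exists v : 'rV_n, v *m v^T = 1%:M /\ (v <= A)%MS.
Proof.
rewrite -nz_row_eq0 => /normalized_row[_]; set v := _ *: nz_row A => vv.
by exists v; split=> //; exact: scalemx_sub (nz_row_sub A).
Qed.

Lemma orthonormal_sub (R : rcfType) m n (A : 'M[R]_(m, n)) r :
  (r <= \rank A)%N ->
  exists Q : 'M_(r, n), Q *m Q^T = 1%:M /\ (Q <= A)%MS.
Proof.
elim: r => [|r IHr] rA.
  by exists 0; split; [apply/matrixP; case | exact: sub0mx].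
have [Q [QQ QA]] := IHr (ltnW rA).
(* Gram-Schmidt by dimension count: [A *m Q^T] has rank at most [r], which is less than the rank of
   [A], so some nonzero vector of the row space of [A] is orthogonal to [Q]. *)
have : (A :&: kermx Q^T)%MS != 0.
  rewrite -mxrank_eq0 -lt0n -(ltn_add2l (\rank (A *m Q^T))) addn0.
  rewrite mxrank_mul_ker.
  exact: leq_ltn_trans (rank_leq_col _) rA.
case/unit_row_sub => v [vv]; rewrite sub_capmx => /andP[vA /sub_kermxP vQ].
have Qv : Q *m v^T = 0 by rewrite -[LHS]trmxK trmx_mul trmxK vQ trmx0.
pose P : 'M_(1 + r, n) := col_mx v Q.
have PP : P *m P^T = 1%:M.
  by rewrite tr_col_mx mul_col_row vv QQ vQ Qv -scalar_mx_block.
by exists P; split=> //; rewrite /P (col_mx_sub v Q) vA.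
Qed.

(** * Characteristic polynomials and orthogonal diagonalization *)

Lemma char_poly_orthogonal_conj (R : comNzRingType) n (P S : 'M[R]_n) :
  P *m P^T = 1%:M -> char_poly (P *m S *m P^T) = char_poly S.
Proof.
move=> PP; rewrite /char_poly /char_poly_mx.
have PP' : map_mx polyC P *m map_mx polyC P^T = 1%:M.
  by rewrite -map_mxM PP map_mx1.
have -> : 'X%:M - map_mx polyC (P *m S *m P^T)
    = map_mx polyC P *m ('X%:M - map_mx polyC S) *m map_mx polyC P^T.
  rewrite mulmxBr mulmxBl !map_mxM /= scalar_mxC -(mulmxA 'X%:M).
  by rewrite PP' mulmx1.
by rewrite !det_mulmx mulrAC -det_mulmx PP' det1 mul1r.
Qed.

Lemma char_poly_block_diag (R : comNzRingType) m n (A : 'M[R]_m) (B : 'M[R]_n) :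
  char_poly (block_mx A 0 0 B) = char_poly A * char_poly B.
Proof.
rewrite /char_poly /char_poly_mx map_block_mx !map_mx0 scalar_mx_block.
by rewrite opp_block_mx add_block_mx !oppr0 !addr0 det_ublock.
Qed.

Lemma char_poly_scalar11 (R : comNzRingType) (a : R) :
  char_poly (a%:M : 'M_1) = 'X - a%:P.
Proof. by rewrite /char_poly det_mx11 !mxE !eqxx. Qed.

(* No appeal to the reality of the spectrum: the eigenvalues are split off as
   long as there are real roots, and whatever remains is the factor [p]. *)
Lemma symmetric_eigenbasis (R : rcfType) n (S : 'M[R]_n) : S^T = S ->
  exists m (e : 'rV[R]_m) (Q : 'M[R]_(m, n)) (p : {poly R}),
    [/\ Q *m Q^T = 1%:M, Q *m S = diag_mx e *m Q,
        char_poly S = p * \prod_i ('X - (e 0 i)%:P) & forall x, ~~ root p x].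
Proof.
elim: n S => [|n IHn] S symS;
  [|have [[x rx]|norx] := pselect (exists x, root (char_poly S) x)].
- exists 0%N, 0, 0, 1; split; first by apply/matrixP; case.
  + by apply/matrixP; case.
  + by rewrite big_ord0 mulr1 /char_poly det_mx00.
  + by move=> x; rewrite root1.
- have : eigenspace S x != 0 by rewrite -eigenvalue_root_char in rx.
  case/unit_row_sub => w [ww /eigenspaceP wS].
  (* [Q1] is an orthonormal basis of the hyperplane orthogonal to the unit eigenvector [w]; the
     induction hypothesis goes to the compression [S'] of [S] to it. *)
  have [|Q1 [QQ1 /sub_kermxP Q1w]] := @orthonormal_sub _ _ _ (kermx w^T) n.
    by rewrite mxrank_ker (leq_trans _ (leq_sub2l _ (rank_leq_col _))) ?subn1.
  have wQ1 : w *m Q1^T = 0 by rewrite -[LHS]trmxK trmx_mul trmxK Q1w trmx0.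
  pose P : 'M_(1 + n) := col_mx w Q1; pose S' := Q1 *m S *m Q1^T.
  have PP : P *m P^T = 1%:M.
    by rewrite /P tr_col_mx mul_col_row ww wQ1 Q1w QQ1 -scalar_mx_block.
  (* Symmetry of [S] makes the complement of an eigenvector invariant. *)
  have Q1Sw : Q1 *m S *m w^T = 0.
    apply: trmx_inj; rewrite trmx0 !trmx_mul trmxK symS mulmxA wS -scalemxAl.
    by rewrite wQ1 scaler0.
  have PSP : P *m S *m P^T = block_mx x%:M 0 0 S'.
    rewrite /P mul_col_mx tr_col_mx mul_col_row Q1Sw wS -!scalemxAl ww wQ1.
    by rewrite scaler0 scale_scalar_mx mulr1.
  have Q1S : Q1 *m S = S' *m Q1.
    rewrite -[LHS]mulmx1 -(mulmx1C PP) mulmxA {1}/P tr_col_mx mul_mx_row Q1Sw.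
    by rewrite /P mul_row_col mul0mx add0r.
  have symS' : S'^T = S' by rewrite /S' !trmx_mul trmxK symS mulmxA.
  have [m [e [Q [p [QQ QS' pS' norp]]]]] := IHn S' symS'.
  (* Eigenvectors of [S'] are written in the coordinates of [Q1]; multiplying by [Q1] lifts them
     back. *)
  exists (1 + m)%N, (row_mx x%:M e), (col_mx w (Q *m Q1)), p; split=> //.
  + rewrite tr_col_mx mul_col_row ww trmx_mul !mulmxA wQ1 mul0mx.
    rewrite -(mulmxA Q Q1 Q1^T) QQ1 mulmx1 QQ -(mulmxA Q Q1) Q1w mulmx0.
    by rewrite -scalar_mx_block.
  + rewrite mul_col_mx wS -mulmxA Q1S mulmxA QS' diag_mx_row mul_block_col.
    rewrite !mul0mx addr0 add0r mulmxA; congr col_mx.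
    by apply/matrixP => i j; rewrite !mxE big_ord1 !mxE !ord1 eqxx !mulr1n.
  + rewrite -(char_poly_orthogonal_conj S PP) PSP.
    transitivity (char_poly (x%:M : 'M_1) * char_poly S').
      by have := char_poly_block_diag (x%:M : 'M[R]_1) S'; rewrite -PSP.
    rewrite pS' char_poly_scalar11 big_split_ord big_ord1 /= row_mxEl mxE eqxx.
    rewrite mulrCA; congr (_ * (_ * _)); apply: eq_bigr => i _.
    by rewrite row_mxEr.
- exists 0%N, 0, 0, (char_poly S); split; first by apply/matrixP; case.
  + by apply/matrixP; case.
  + by rewrite big_ord0 mulr1.
  + by move=> x; apply/negP => rx; apply: norx; exists x.
Qed.

(** * Spectral norm against Frobenius norm *)

Lemma l2normE (R : realType) n (x : 'cV[R]_n) :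
  l2norm x = Num.sqrt (frobsq x).
Proof.
by rewrite frobsqE; congr Num.sqrt; apply: eq_bigr => i _; rewrite big_ord1.
Qed.

(** The projection inequality for the one-row orthonormal family obtained by normalizing [x^T]. It
    bounds the set whose supremum is [spectral_norm]. *)
Lemma frobsq_mul_col_le (R : rcfType) m n (A : 'M[R]_(m, n))
    (x : 'cV[R]_n) :
  frobsq (A *m x) <= frobsq A * frobsq x.
Proof.
have [->|x0] := eqVneq x 0.
  by rewrite mulmx0 !frobsq_0 mulr0.
have xT0 : x^T != 0 by rewrite trmx_eq0.
have [] := normalized_row xT0; rewrite frobsq_tr; set s := Num.sqrt _ => s0.
move=> /(@frobsq_mul_orthonormal_le _ 1 n m A).
rewrite linearZ /= trmxK -scalemxAr frobsqZ exprVn sqr_sqrtr ?frobsq_ge0//.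
by rewrite mulrC ler_pdivrMr // lt_def frobsq_eq0 x0 frobsq_ge0.
Qed.

Lemma l2norm_mul_le_spectral (R : realType) m n (A : 'M[R]_(m, n))
    (x : 'cV[R]_n) :
  l2norm x <= 1 -> l2norm (A *m x) <= spectral_norm A.
Proof.
move=> x_le1; apply: ub_le_sup; last by exists x.
exists (Num.sqrt (frobsq A)) => _ [y /= y_le1 <-]; rewrite l2normE.
apply: ler_wsqrtr; apply: le_trans (frobsq_mul_col_le _ _) _.
rewrite ler_piMr ?frobsq_ge0//; move: y_le1; rewrite l2normE -{1}sqrtr1.
by rewrite ler_sqrt.
Qed.

Lemma spectral_norm_ge0 (R : realType) m n (A : 'M[R]_(m, n)) :
  0 <= spectral_norm A.
Proof.
apply: le_trans (sqrtr_ge0 _) (l2norm_mul_le_spectral A (x := 0) _).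
by rewrite l2normE frobsq_0 sqrtr0 ler01.
Qed.

Lemma frobsq_mul_col_le_spectral (R : realType) m n (A : 'M[R]_(m, n))
    (x : 'cV[R]_n) :
  frobsq (A *m x) <= spectral_norm A ^+ 2 * frobsq x.
Proof.
have [->|x0] := eqVneq x 0.
  by rewrite mulmx0 !frobsq_0 mulr0.
have xT0 : x^T != 0 by rewrite trmx_eq0.
have fx : 0 < frobsq x by rewrite lt_def frobsq_eq0 x0 frobsq_ge0.
have [] := normalized_row xT0; rewrite frobsq_tr.
set s := Num.sqrt _ => s0 vv.
have s2 : s ^+ 2 = frobsq x by rewrite sqr_sqrtr ?ltW.
have {vv} y1 : frobsq (s^-1 *: x) = 1.
  by rewrite frobsqZ exprVn s2 mulVf ?gt_eqF.
have : l2norm (A *m (s^-1 *: x)) <= spectral_norm A.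
  by apply: l2norm_mul_le_spectral; rewrite l2normE y1 sqrtr1.
rewrite l2normE -scalemxAr => le.
have := le; rewrite -ler_sqr ?nnegrE ?spectral_norm_ge0 ?sqrtr_ge0//.
rewrite sqr_sqrtr ?frobsq_ge0// frobsqZ exprVn s2.
by rewrite mulrC ler_pdivrMr.
Qed.

Lemma frobsq_mul_le_spectral (R : realType) m n p (A : 'M[R]_(m, n))
    (B : 'M[R]_(n, p)) :
  frobsq (A *m B) <= spectral_norm A ^+ 2 * frobsq B.
Proof.
rewrite !frobsq_sum_col mulr_sumr; apply: ler_sum => j _.
by rewrite colE -mulmxA -colE frobsq_mul_col_le_spectral.
Qed.

(** With [Q] an orthonormal basis of the row space, [A] and [A *m Q^T] have the same Frobenius norm,
    and [frobsq Q^T] is the rank. *)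
Lemma frobsq_le_rank_spectral (R : realType) m n (A : 'M[R]_(m, n)) :
  frobsq A <= (\rank A)%:R * spectral_norm A ^+ 2.
Proof.
have [Q [QQ QA]] := orthonormal_sub (leqnn (\rank A)).
have : (A <= Q)%MS.
  have := mxrank_leqif_sup QA.
  by rewrite (eqP (orthonormal_row_free QQ)) => -[_ <-].
(* Generalizing the rank frees the type of [Q] from [A], so that [A] can be rewritten as
   [D *m Q]. *)
move: (\rank A) Q QQ {QA} => r Q QQ /submxP[D AE].
have -> : frobsq A = frobsq (A *m Q^T).
  rewrite /frobsq AE -(mulmxA D Q Q^T) QQ mulmx1.
  by rewrite trmx_mul mulmxA -(mulmxA D) QQ mulmx1.
by rewrite mulrC -(frobsq_orthonormal QQ) -(frobsq_tr Q) frobsq_mul_le_spectral.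
Qed.

(** * Counting Gram eigenvalues and singular values *)

Lemma count_mem_flatten_nseq (T : eqType) (f : T -> nat) (s : seq T) y :
  uniq s ->
  count_mem y (flatten [seq nseq (f x) x | x <- s]) = ((y \in s) * f y)%N.
Proof.
elim: s => //= x s IHs /andP[xs /IHs sE].
rewrite count_cat sE count_nseq /= in_cons [y == x]eq_sym.
by have [<-|] := eqVneq x y; rewrite ?(negPf xs) ?mul1n ?addn0.
Qed.

Lemma mup_prod_XsubC (R : fieldType) (s : seq R) x :
  mup x (\prod_(z <- s) ('X - z%:P)) = count_mem x s.
Proof.
elim: s => [|z s IHs]; first by rewrite big_nil mupNroot ?root1.
rewrite big_cons mupM ?polyXsubC_eq0 ?monic_neq0 ?monic_prod_XsubC// IHs /=.
by rewrite -['X - _]expr1 mup_XsubCX; case: (_ == _).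
Qed.

(** Both lists contain each [y] as often as its multiplicity in the characteristic polynomial, to
    which the rootless factor [p] contributes nothing. *)
Lemma gram_eigenvalues_perm (R : realType) m n (A : 'M[R]_(m, n)) (p : {poly R})
    (s : seq R) :
    char_poly (A^T *m A) = p * \prod_(z <- s) ('X - z%:P) ->
    (forall x, ~~ root p x) ->
  perm_eq (gram_eigenvalues A) s.
Proof.
move=> pE norp; apply/allP => y _ /=; rewrite /gram_eigenvalues.
rewrite count_mem_flatten_nseq ?rev_uniq ?uniq_roots// mem_rev.
have c0 : char_poly (A^T *m A) != 0 by rewrite monic_neq0 ?char_poly_monic.
have := roots_on_rootsR c0 y; rewrite in_itv /= => <-.
have -> : (root (char_poly (A^T *m A)) y * mup y (char_poly (A^T *m A)))%N
          = mup y (char_poly (A^T *m A)).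
  by case: (boolP (root _ _)) => [_|/mupNroot->]; rewrite ?mul1n ?muln0.
by rewrite pE mupMr// mup_prod_XsubC.
Qed.

(** Reading past the end of [s] yields only the default [x0], which is not counted. *)
Lemma count_mkseq_nth_le (T : Type) (a : pred T) (x0 : T) (s : seq T) m :
  ~~ a x0 -> (count a (mkseq (nth x0 s) m) <= count a s)%N.
Proof.
move=> ax0; elim: m s => [|m IHm] [|x s] //=.
  rewrite (negPf ax0) (iotaDl 1 0) -map_comp; apply: leq_trans (IHm [::]).
  by rewrite (eq_map (_ : _ =1 nth x0 [::])) // => i; rewrite /= !nth_nil.
by rewrite leq_add2l (iotaDl 1 0) -map_comp IHm.
Qed.

Lemma large_singular_space (R : realType) m n (A : 'M[R]_(m, n)) (c : R) :
    0 <= c ->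
  exists N (e : 'rV[R]_N) (Q : 'M[R]_(N, n)),
    [/\ Q *m Q^T = 1%:M, Q *m (A^T *m A) = diag_mx e *m Q,
        forall i, c ^+ 2 < e 0 i &
        (#|[set j : 'I_(minn m n) | (c < singular_value A j)%R]| <= N)%N].
Proof.
move=> c0.
have [|N [e [Q [p [QQ QS pE norp]]]]] := @symmetric_eigenbasis _ _ (A^T *m A).
  by rewrite trmx_mul trmxK.
pose s := [seq e 0 i | i <- enum 'I_N].
pose I := [set i | c < Num.sqrt (e 0 i)].
pose f (i : 'I_#|I|) := enum_val i.
exists #|I|, (colsub f e), (rowsub f Q); split.
- apply/matrixP => i j; have /matrixP/(_ (f i) (f j)) := QQ.
  rewrite !mxE (inj_eq enum_val_inj) => <-.
  by apply: eq_bigr => l _; rewrite !mxE.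
- rewrite mul_rowsub_mx QS; apply/matrixP => i j.
  by rewrite mxE !mul_diag_mx !mxE.
- move=> i; have := enum_valP i; rewrite inE mxE => ci.
  (* The square root of a negative number is 0, so positivity of the eigenvalue must be secured
     before squaring. *)
  have ei : 0 < e 0 (f i) by rewrite -sqrtr_gt0 (le_lt_trans c0 ci).
  by rewrite -(sqr_sqrtr (ltW ei)) ltrXn2r ?nnegrE ?sqrtr_ge0.
have /permP pG : perm_eq (gram_eigenvalues A) s.
  by apply: gram_eigenvalues_perm norp; rewrite pE big_map big_enum.
pose a x := c < Num.sqrt x.
have -> : #|I| = count a s.
  rewrite count_map cardE -size_filter; congr size.
  by rewrite enumT; apply: eq_filter => i; rewrite [LHS]inE.
rewrite -pG.
(* The default singular value is 0, which does not exceed [c] because [0 <= c]. *)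
apply: leq_trans (@count_mkseq_nth_le _ a 0 _ (minn m n) _); last first.
  by rewrite /a sqrtr0 -leNgt; exact: c0.
rewrite /mkseq -val_enum_ord -map_comp count_map cardE -size_filter.
rewrite eq_leq//; congr size; rewrite enumT.
by apply: eq_filter => i; rewrite [LHS]inE.
Qed.

(** * The counting bound for [Phi] *)

Theorem theorem2 (R : realType) (k L df d : nat)
    (hk : (0 < k)%N) (hL : (0 < L)%N) (hdf : (0 < df)%N) (hd : (0 < d)%N)
    (hkd : (k < d)%N)
    (W1 : 'M[R]_(df, k)) (W2 : 'M[R]_(d, df)) (W3 : 'M[R]_(d, k))
    (omega : R -> R) (homega : forall x : R, `|omega x| <= `|x|)
    (X : 'M[R]_(k, L)) (eps : R) (heps : 0 < eps) :
  #|[set j : 'I_(minn d L) |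
      eps * spectral_norm W2 * spectral_norm (W1 *m X)
        < singular_value (Phi W1 W2 W3 omega X) j]|%:R
    <= (1 + eps ^- 2) * k%:R :> R.
Proof.
set s1 := spectral_norm (W1 *m X); set s2 := spectral_norm W2.
set F := Phi W1 W2 W3 omega X.
have c0 : 0 <= eps * s2 * s1 by rewrite !mulr_ge0 ?spectral_norm_ge0 ?ltW.
have [N [e [Q [QQ QF e_gt le_N]]]] := large_singular_space F c0.
(* [M] is the dimension of the space of combinations of the rows of [Q] that [X] kills; [Q *m X^T]
   has [k] columns, so at most [k] dimensions are lost. *)
set M := \rank (kermx (Q *m X^T)).
have N_le : (N <= k + M)%N.
  rewrite /M mxrank_ker -leq_subLR leq_sub2l//; exact: rank_leq_col.
apply: (@le_trans _ _ (k%:R + M%:R)).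
  by rewrite -natrD ler_nat (leq_trans le_N).
rewrite mulrDl mul1r lerD2l mulrC ler_pdivlMr ?exprn_gt0//.
have [->|M_gt0] := posnP M; first by rewrite mul0r.
have [C [CC /sub_kermxP CQX]] := orthonormal_sub (leqnn M).
pose U := C *m Q.
have UU : U *m U^T = 1%:M by rewrite trmx_mul mulmxA -(mulmxA C) QQ mulmx1.
have XU : X *m U^T = 0 by rewrite -[LHS]trmxK trmx_mul trmxK -mulmxA CQX trmx0.
have lower : (eps * s2 * s1) ^+ 2 * M%:R < frobsq (F *m U^T).
  have -> : frobsq (F *m U^T) = \tr (C *m diag_mx e *m C^T).
    rewrite /frobsq mxtrace_mulC trmx_mul trmxK mulmxA -(mulmxA U) /U.
    rewrite -(mulmxA C) QF mulmxA -(mulmxA (C *m diag_mx e)) trmx_mul.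
    by rewrite (mulmxA Q) QQ mul1mx.
  have -> : \tr (C *m diag_mx e *m C^T) = \sum_i \sum_j e 0 j * C i j ^+ 2.
    apply: eq_bigr => i _; rewrite mxE; apply: eq_bigr => j _.
    by rewrite mul_mx_diag !mxE expr2 mulrAC mulrC.
  (* [C'] is chosen so that [frobsq C'] is the difference of the two sides. It is nonzero, as all
     gaps are positive and [frobsq C] is [M], which gives strictness. *)
  pose C' := \matrix_(i, j) (Num.sqrt (e 0 j - (eps * s2 * s1) ^+ 2) * C i j).
  have gap0 j : 0 < e 0 j - (eps * s2 * s1) ^+ 2 by rewrite subr_gt0.
  have C'0 : C' != 0.
    apply: contraTneq M_gt0 => /matrixP C'0; rewrite -leqNgt leqn0 -(eqr_nat R).
    rewrite -(frobsq_orthonormal CC) frobsq_eq0; apply/eqP/matrixP => i j.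
    have /eqP := C'0 i j; rewrite !mxE mulf_eq0 gt_eqF ?sqrtr_gt0//=.
    by move/eqP.
  rewrite -subr_gt0; apply: (@lt_le_trans _ _ (frobsq C')).
    by rewrite lt_def frobsq_eq0 C'0 frobsq_ge0.
  rewrite le_eqVlt; apply/orP; left; apply/eqP.
  rewrite -(frobsq_orthonormal CC) !frobsqE mulr_sumr -sumrB.
  apply: eq_bigr => i _; rewrite mulr_sumr -sumrB; apply: eq_bigr => j _.
  by rewrite mxE exprMn sqr_sqrtr ?ltW// mulrBl.
have upper : frobsq (F *m U^T) <= s2 ^+ 2 * (k%:R * s1 ^+ 2).
  (* The linear term [W3 *m X] dies on [U^T], whatever [W3] is. *)
  have -> : F *m U^T = W2 *m (map_mx omega (W1 *m X) *m U^T).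
    by rewrite /F /Phi mulmxDl -mulmxA XU mulmx0 add0r mulmxA.
  apply: le_trans (frobsq_mul_le_spectral _ _) _.
  rewrite ler_wpM2l ?sqr_ge0//.
  apply: le_trans (frobsq_mul_orthonormal_le _ UU) _.
  apply: (@le_trans _ _ (frobsq (W1 *m X))).
    rewrite !frobsqE; do 2 (apply: ler_sum => ? _); rewrite mxE.
    by rewrite -[leLHS]real_normK ?num_real// -[leRHS]real_normK ?num_real//
      lerXn2r ?nnegrE.
  apply: le_trans (frobsq_le_rank_spectral _) _.
  rewrite ler_wpM2r ?sqr_ge0// ler_nat.
  exact: leq_trans (mxrankM_maxl _ _) (rank_leq_col _).
have := lt_le_trans lower upper.
have -> : (eps * s2 * s1) ^+ 2 * M%:R = (s2 * s1) ^+ 2 * (M%:R * eps ^+ 2).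
  by ring.
have -> : s2 ^+ 2 * (k%:R * s1 ^+ 2) = (s2 * s1) ^+ 2 * k%:R by ring.
(* When [s2 * s1] vanishes, the strict lower bound and the upper bound would give [0 < 0]; otherwise
   the common factor cancels. *)
have [->|s0] := eqVneq (s2 * s1) 0; first by rewrite expr0n !mul0r ltxx.
by rewrite ltr_pM2l ?exprn_even_gt0// => /ltW.
Qed.
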